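(* Let $K$ be a field. Consider any monomial order defined by a positive tuple $\overline{T}=(T_1,\ldots,T_r)$ of nonnegative linear forms on $\mathbb{N}^n$. Let $f_1,\ldots,f_k\in K[[u,v]]=K[[u_1,\ldots,u_n,v_1,\ldots,v_m]]$ be formal power series. Assume that the initial exponents $\alpha_i:=\exp_{\overline{T}}(f_i(u,0))\in\mathbb{N}^n$, $i=1,\ldots,k$, exist. Let $\Delta$ be the diagram defined by the exponents $\alpha_1,\ldots,\alpha_k$, with the associated sets $\Gamma,\Gamma_1,\ldots,\Gamma_k\subset\mathbb{N}^n$. Then for every $g\in K[[u,v]]$ there exist unique $h_i\in K[[u,v]]$ and $r(g)\in K[[u,v]]$ such that $\operatorname{supd}(h_i)\subset\Gamma_i\times\mathbb{N}^m$, $\operatorname{supd}(r(g))\subset\Gamma\times\mathbb{N}^m$, and $$g=\sum_{i=1}^k h_if_i+r(g).$$ Moreover, if $\operatorname{ord}(f_i)=|\alpha_i|$ for all $i$, then $\operatorname{ord}(r(g))\geq\operatorname{ord}(g)$ and $\operatorname{ord}(h_i)\geq\operatorname{ord}(g)-|\alpha_i|$.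
   Context: $\mathbb{N}$ includes $0$. A linear form $a_1x_1+\ldots+a_nx_n$ on $\mathbb{R}^n$ is nonnegative if all $a_i\ge 0$. A tuple $\overline{T}=(T_1,\ldots,T_r)$ of nonnegative linear forms is positive if for every nonzero $a\in\mathbb{N}^n$ at least one $T_i(a)>0$. It defines a (partial) monomial order on $\mathbb{N}^n$: $\alpha\le_{\overline T}\beta$ iff $\overline{T}(\alpha)\le_{\rm lex}\overline{T}(\beta)$. For $f=\sum c_\alpha u^\alpha$: $\operatorname{supp}(f)=\{\alpha: c_\alpha\ne0\}$. The initial exponent $\exp_{\overline T}(f)$ exists and equals $\beta$ if $\beta$ is the unique element of $\operatorname{supp}(f)$ at which $\overline{T}$ attains its (lexicographic) minimum on $\operatorname{supp}(f)$. $\operatorname{supd}(f)=\{\alpha: D_{\alpha}(f)\neq0\}$ where $D_{\alpha}=\frac{1}{\alpha!}\partial^{\alpha}$ are the Hasse derivatives (with respect to all variables, so in $\mathbb{N}^{n+m}$ for $K[[u,v]]$). $|\alpha|=\alpha_1+\ldots+\alpha_n$, and $\operatorname{ord}(f)$ is the smallest total degree of a monomial occurring in $f$. The ordered exponents $\alpha_1,\ldots,\alpha_k$ define the diagram $\Delta=\bigcup_i(\alpha_i+\mathbb{N}^n)$, the sets $\Delta_j=(\alpha_j+\mathbb{N}^n)\setminus\bigcup_{i<j}(\alpha_i+\mathbb{N}^n)$, $\Gamma=\mathbb{N}^n\setminus\Delta$, and $\Gamma_j=\Delta_j-\alpha_j\subset\mathbb{N}^n$ (so $\Delta_j=\alpha_j+\Gamma_j$).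 *)

(* Defs.v *)
From HB Require Import structures.
From mathcomp Require Import all_boot all_order all_algebra.
From mathcomp Require Import boolp classical_sets functions.
From mathcomp Require Import reals.
From mathcomp Require constructive_ereal.
From mathcomp.multinomials Require Import mpoly.
(* The notations of constructive_ereal clash with those of mpoly. *)
Import -(notations) constructive_ereal.

Set Implicit Arguments.
Unset Strict Implicit.
Unset Printing Implicit Defensive.

Import Order.TTheory GRing.Theory Num.Theory.

Local Open Scope classical_set_scope.
Local Open Scope ring_scope.

(* The formal power series ring K[[x_1, ..., x_d]]; [f a] is the coefficient *)
(* of the monomial x^a in f.                                                 *)
Record mpseries (K : Type) (d : nat) :=
  MPSeries { mpscoef :> 'X_{1..d} -> K }.

Notation "'{mps' K [ d ] }" := (mpseries K d)
  (at level 0, K at level 2, format "'{mps'  K [ d ] }") : type_scope.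

Lemma mpseriesP K d (f g : {mps K[d]}) : f =1 g -> f = g.
Proof. by case: f => f; case: g => g fg; congr MPSeries; apply/funext. Qed.

Lemma mpscoefK K d : cancel (@mpscoef K d) (@MPSeries K d).
Proof. by case. Qed.

HB.instance Definition _ (K : choiceType) d :=
  Choice.copy {mps K[d]} (can_type (@mpscoefK K d)).

Section Ring.
Context (K : comNzRingType) (d : nat).
Implicit Types f g h : {mps K[d]}.

Definition mps0 : {mps K[d]} := MPSeries (fun _ => 0).
Definition mps_opp f : {mps K[d]} := MPSeries (fun a => - f a).
Definition mps_add f g : {mps K[d]} := MPSeries (fun a => f a + g a).
Definition mps1 : {mps K[d]} := MPSeries (fun a => (a == 0%MM)%:R).
Definition mps_mul f g : {mps K[d]} := MPSeries (fun a =>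
  \sum_(b : 'X_{1..d < (mdeg a).+1, (mdeg a).+1} | a == (b.1 + b.2)%MM)
     f b.1 * g b.2).

Lemma mps_addA : associative mps_add.
Proof. by move=> f g h; apply: mpseriesP => a /=; rewrite addrA. Qed.
Lemma mps_addC : commutative mps_add.
Proof. by move=> f g; apply: mpseriesP => a /=; rewrite addrC. Qed.
Lemma mps_add0 : left_id mps0 mps_add.
Proof. by move=> f; apply: mpseriesP => a /=; rewrite add0r. Qed.
Lemma mps_addN : left_inverse mps0 mps_opp mps_add.
Proof. by move=> f; apply: mpseriesP => a /=; rewrite addNr. Qed.

HB.instance Definition _ := GRing.isZmodule.Build {mps K[d]}
  mps_addA mps_addC mps_add0 mps_addN.

Let trunc b f : {mpoly K[d]} := \sum_(a : 'X_{1..d < b}) f a *: 'X_[a].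

Let truncE b f a : (mdeg a < b)%N -> (trunc b f)@_a = f a.
Proof.
move=> ab; rewrite raddf_sum (bigD1 (BMultinom ab)) //= big1 ?addr0 => [|c].
  by rewrite mcoeffZ mcoeffX eqxx mulr1.
rewrite -(inj_eq val_inj) /= => /negPf ca.
by rewrite mcoeffZ mcoeffX ca mulr0.
Qed.

Let mul_trunc b f g a : (mdeg a < b)%N ->
  mps_mul f g a = (trunc b f * trunc b g)@_a.
Proof.
move=> ab; rewrite mcoeffM; apply: eq_bigr => -[c1 c2] /= _.
by rewrite !truncE // (leq_trans (bmdeg _)).
Qed.

Let mul_mpoly b f g (p q : {mpoly K[d]}) :
  (forall a, (mdeg a < b)%N -> f a = p@_a) ->
  (forall a, (mdeg a < b)%N -> g a = q@_a) ->
  forall a, (mdeg a < b)%N -> mps_mul f g a = (p * q)@_a.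
Proof.
move=> fp gq a ab; rewrite mcoeffM; apply: eq_bigr => -[c1 c2] /= _.
by rewrite fp ?gq // (leq_trans (bmdeg _)).
Qed.

Let truncE' b f a : (mdeg a < b)%N -> f a = (trunc b f)@_a.
Proof. by move=> ab; rewrite truncE. Qed.

Lemma mps_mulA : associative mps_mul.
Proof.
move=> f g h; apply: mpseriesP => a; have ab := ltnSn (mdeg a).
pose E := @truncE' (mdeg a).+1.
rewrite (mul_mpoly (E f) (mul_mpoly (E g) (E h)) ab).
by rewrite (mul_mpoly (mul_mpoly (E f) (E g)) (E h) ab) mulrA.
Qed.

Lemma mps_mulC : commutative mps_mul.
Proof.
move=> f g; apply: mpseriesP => a; have ab := ltnSn (mdeg a).
by rewrite !(mul_trunc _ _ ab) mulrC.
Qed.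

Lemma mps_mul1 : left_id mps1 mps_mul.
Proof.
move=> f; apply: mpseriesP => a; have ab := ltnSn (mdeg a).
rewrite (@mul_mpoly (mdeg a).+1 _ _ 1 (trunc (mdeg a).+1 f)) //.
- by rewrite mul1r truncE.
- by move=> c _; rewrite mcoeff1.
- by move=> c cb; rewrite truncE.
Qed.

Lemma mps_mulDl : left_distributive mps_mul +%R.
Proof.
move=> f g h; apply: mpseriesP => a /=.
by rewrite -big_split /=; apply: eq_bigr => b _; rewrite mulrDl.
Qed.

Lemma mps1_neq0 : mps1 != 0.
Proof.
apply/eqP => /(congr1 (fun f : {mps K[d]} => f 0%MM)) /=.
by rewrite eqxx; apply/eqP/oner_neq0.
Qed.

HB.instance Definition _ := GRing.Zmodule_isComNzRing.Build {mps K[d]}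
  mps_mulA mps_mulC mps_mul1 mps_mulDl mps1_neq0.

End Ring.

Section Series.
Context (K : fieldType) (d : nat).
Implicit Types f : {mps K[d]}.

Definition supp f : set 'X_{1..d} := [set a | f a != 0].

(* The Hasse derivative (1/a!) * partial^a, which over any K is given by     *)
(* x^c |-> binomial(c, a) x^(c - a).                                         *)
Definition hasse (a : 'X_{1..d}) f : {mps K[d]} := MPSeries (fun b =>
  f (a + b)%MM *+ (\prod_(i < d) 'C((a + b)%MM i, a i))%N).

Definition supd f : set 'X_{1..d} := [set a | hasse a f != 0].

(* ord 0 = +oo. *)
Definition ord f : extended int :=
  match pselect (exists e, `[< exists2 a, supp f a & mdeg a = e >]) with
  | left ex => EFin (ex_minn ex)%:Z
  | right _ => EPInf int
  end.

End Series.

Section MonomialOrder.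
Context (R : realType) (n r : nat).

(* The linear form a_1 x_1 + ... + a_n x_n at a point of N^n. *)
Definition linform (a : 'rV[R]_n) (x : 'X_{1..n}) : R :=
  \sum_(j < n) a 0 j * (x j)%:R.

Definition nonneg_form (a : 'rV[R]_n) := forall j, 0 <= a 0 j.

Implicit Types T : r.-tuple 'rV[R]_n.

Definition positive_forms T :=
  forall x : 'X_{1..n}, x <> 0%MM -> exists i, 0 < linform (tnth T i) x.

Definition forms_val T (x : 'X_{1..n}) : r.-tuplelexi R :=
  [tuple linform (tnth T i) x | i < r].

Definition le_forms T (x y : 'X_{1..n}) : bool :=
  (forms_val T x <= forms_val T y)%O.

Definition attains_min T (S : set 'X_{1..n}) (x : 'X_{1..n}) :=
  S x /\ forall y, S y -> le_forms T x y.

Definition is_initial_exp T (K : fieldType) (f : {mps K[n]}) (x : 'X_{1..n}) :=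
  unique (attains_min T (supp f)) x.

End MonomialOrder.

(* The identification of N^n x N^m with N^(n + m); the variables u_1, ..., u_n *)
(* come first, v_1, ..., v_m last.                                             *)
Definition mnm_pair n m (a : 'X_{1..n}) (b : 'X_{1..m}) : 'X_{1..n + m} :=
  [multinom match fintype.split i with inl j => a j | inr j => b j end | i < n + m].

(* A x N^m *)
Definition cylinder n m (A : set 'X_{1..n}) : set 'X_{1..n + m} :=
  [set mnm_pair p.1 p.2 | p in A `*` [set: 'X_{1..m}]].

(* f(u, 0) *)
Definition eval_v0 (K : fieldType) n m (f : {mps K[n + m]}) : {mps K[n]} :=
  MPSeries (fun a => f (mnm_pair a 0%MM)).

Section Diagram.
Context (n k : nat) (alpha : 'I_k -> 'X_{1..n}).

(* a + N^n *)
Definition orthant (a : 'X_{1..n}) : set 'X_{1..n} :=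
  [set (a + c)%MM | c in [set: 'X_{1..n}]].

Definition diagram : set 'X_{1..n} := \bigcup_i orthant (alpha i).

Definition diagram_part (j : 'I_k) : set 'X_{1..n} :=
  orthant (alpha j) `\` \bigcup_(i in [set i : 'I_k | (i < j)%N]) orthant (alpha i).

Definition Gamma : set 'X_{1..n} := ~` diagram.

(* the translate Delta_j - alpha_j *)
Definition Gamma_part (j : 'I_k) : set 'X_{1..n} :=
  [set c | diagram_part j (alpha j + c)%MM].

End Diagram.

Definition is_division (K : fieldType) n m k (f : 'I_k -> {mps K[n + m]})
    (alpha : 'I_k -> 'X_{1..n}) (g : {mps K[n + m]})
    (h : 'I_k -> {mps K[n + m]}) (rem : {mps K[n + m]}) :=
  [/\ forall i, supd (h i) `<=` cylinder (Gamma_part alpha i),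
      supd rem `<=` cylinder (Gamma alpha) &
      g = \sum_(i < k) h i * f i + rem].

(* Main.v *)
Require Import Defs.
From mathcomp Require Import all_boot all_order all_algebra.
From mathcomp Require Import boolp classical_sets functions.
From mathcomp Require Import reals.
From mathcomp Require constructive_ereal.
From mathcomp.multinomials Require Import mpoly.
From mathcomp Require Import lra.
Import -(notations) constructive_ereal.

Set Implicit Arguments.
Unset Strict Implicit.
Unset Printing Implicit Defensive.

Import Order.TTheory GRing.Theory Num.Theory.
Local Open Scope ring_scope.

(** Division with respect to a lexicographic order on linear forms cannot be
run as a term-by-term reduction: below a given exponent there may be infinitely
many others.  The idea is to trade the forms T for a single weighted degree
with natural coefficients on the exponents of all the variables u, v, for which
alpha_i (extended by 0) is the strict minimum on the support of f_i
([initial_weight]).  This is possible although the supports are infinite, since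
a nonnegative form takes only finitely many values below any bound: its values
above T_j(alpha_i) keep a positive distance from it, so that a combination
M_1 T_1 + M_2 T_2 + ... whose coefficients decrease fast enough detects every
lexicographic inequality alpha_i < y by a uniform gap ([lex_form]), and a
uniform gap survives rounding the coefficients to integers ([lex_weight]).  The
variables v are given a weight exceeding that of every alpha_i, so that only
f_i(u, 0) matters for the minimum.

For such a weight the division is a triangular linear system.  Every exponent c
either has a unique first divisor alpha_i, and then c stands for the unknown
coefficient of h_i at c - alpha_i, or lies outside the diagram, and then c
stands for the unknown coefficient of the remainder.  The coefficient at c of
the sum of the h_i f_i and the remainder is a nonzero multiple of the unknown
attached to c, plus a combination of unknowns attached to exponents of smaller
weight ([divisionE], [lead_mul_quot], [eq_tail_mul]).  Existence follows by
recursion on the weight ([graded_fixpoint], [division_exists]).  Uniqueness and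
the bounds on the orders both follow from one induction on the weight
([division_vanish]): if g vanishes on a set P of exponents which the system
relates only to exponents in P, then so do the unknowns attached to P.  The set
of all exponents gives uniqueness, the set of exponents of total degree less
than ord g gives the bounds.

Finally, Gamma_i and Gamma are stable under taking divisors, so bounding the
support of the Hasse derivatives by them amounts to bounding the support
itself ([supd_sub_cylinder]). *)

(** * Weighted degrees refining a lexicographic order *)

Definition wdeg d (w : 'I_d -> nat) (x : 'X_{1..d}) := (\sum_j w j * x j)%N.

Lemma wdegD d (w : 'I_d -> nat) x y : wdeg w (x + y)%MM = (wdeg w x + wdeg w y)%N.
Proof.
by rewrite -big_split; apply: eq_bigr => j _; rewrite mnmDE mulnDr.
Qed.

Section Weights.
Context (R : realType) (n : nat).
Implicit Types (t : 'rV[R]_n) (x y : 'X_{1..n}).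

Lemma linform_ge0 t x : nonneg_form t -> 0 <= linform t x.
Proof. by move=> t0; apply: sumr_ge0 => j _; rewrite mulr_ge0. Qed.

Lemma linformDZ (c : R) t u x :
  linform (c *: t + u) x = c * linform t x + linform u x.
Proof.
rewrite /linform mulr_sumr -big_split /=; apply: eq_bigr => j _.
by rewrite !mxE mulrDl mulrA.
Qed.

(** Restricting to the coordinates seen by the form makes the sublevel sets of
the form finite, without changing its value. *)
Definition form_support t x : 'X_{1..n} :=
  [multinom (if t 0%R j == 0%R then 0 else x j) | j < n].

Lemma linform_support t x : linform t (form_support t x) = linform t x.
Proof.
apply: eq_bigr => j _; rewrite mnmE.
by case: eqP => [->|//]; rewrite !mul0r.
Qed.

Lemma mdeg_support_le t : nonneg_form t ->
  exists c : R, forall x, (mdeg (form_support t x))%:R <= c * linform t x.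
Proof.
move=> t0; exists (\sum_j (t 0 j)^-1) => x.
have inv_ge0 j : 0 <= (t 0 j)^-1 by rewrite invr_ge0.
rewrite mdegE natr_sum mulr_sumr ler_sum // => j _; rewrite mnmE.
have [_|tj] := eqVneq; first by rewrite mulr_ge0 ?sumr_ge0 ?mulr_ge0.
rewrite mulrA ler_peMl // (bigD1 j) //= mulrDl mulVf //.
by rewrite lerDl mulr_ge0 // sumr_ge0.
Qed.

(** The values of a nonnegative form form a discrete set, so those above the
value at x cannot accumulate there. *)
Lemma linform_gap t x : nonneg_form t ->
  exists2 c : R, 0 <= c &
    forall y, linform t x < linform t y -> 1 <= c * (linform t y - linform t x).
Proof.
move=> t0; have [c0 c0P] := mdeg_support_le t0.
(* An exponent whose value exceeds that of x by less than 1 has, after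
   restriction, degree less than b.  In the constant 1 + sum of inverse gaps,
   the sum serves these finitely many exponents and 1 serves all others. *)
pose b := Num.Def.archi_bound (`|c0| * (linform t x + 1)).
pose gap (z : 'X_{1..n < b}) : R := `|(linform t z - linform t x)^-1|.
have gap_ge0 z : 0 <= gap z by exact: normr_ge0.
exists (1 + \sum_z gap z) => [|y]; first by rewrite addr_ge0 ?sumr_ge0.
rewrite -subr_gt0; set D : R := _ - _ => D0.
have [D1|D1] := leP 1 D.
  rewrite (le_trans D1) // ler_peMl ?(ltW D0) // lerDl sumr_ge0 //.
have tx := linform_ge0 x t0; have ty := linform_ge0 y t0.
have yb : (mdeg (form_support t y) < b)%N.
  rewrite -(ltr_nat R); apply: le_lt_trans (archi_boundP _); last first.
    by rewrite mulr_ge0 ?addr_ge0.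
  apply: (le_trans (c0P y)); apply: (le_trans (ler_wpM2r ty (ler_norm c0))).
  by rewrite ler_wpM2l //; move: D1; rewrite /D; lra.
rewrite (bigD1 (BMultinom yb)) //= {1}/gap /= linform_support -/D.
rewrite ger0_norm ?invr_ge0 ?(ltW D0) // mulrDl mulrDl mulVf ?gt_eqF // mul1r.
have : 0 <= (\sum_(z | z != BMultinom yb) gap z) * D.
  by rewrite mulr_ge0 ?(ltW D0) // sumr_ge0.
by lra.
Qed.

Context (k : nat) (alpha : 'I_k -> 'X_{1..n}).

(** One constant serves finitely many points: add up theirs. *)
Lemma linform_gaps t : nonneg_form t ->
  exists2 c : R, 0 <= c & forall i y,
    linform t (alpha i) < linform t y ->
    1 <= c * (linform t y - linform t (alpha i)).
Proof.
move=> t0; have gapE i : exists c : R, 0 <= c /\ forall y,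
    linform t (alpha i) < linform t y ->
    1 <= c * (linform t y - linform t (alpha i)).
  by have [c ? ?] := linform_gap (alpha i) t0; exists c.
have [c cP] := choice gapE; exists (\sum_i c i) => [|i y ltxy].
  by apply: sumr_ge0 => i _; case: (cP i).
case: (cP i) => ci0 /(_ y ltxy)/le_trans; apply.
rewrite ler_wpM2r ?subr_ge0 ?(ltW ltxy) // (bigD1 i) //= lerDl.
by apply: sumr_ge0 => j _; case: (cP j).
Qed.

(** A single form replaces the lexicographic order for comparisons with the
given finitely many points.  Nonnegativity of the forms is what makes this
work for all y at once: when the first form decides, the remaining ones can
lower the difference at most by their value at alpha i, whatever y is. *)
Lemma lex_form (s : seq 'rV[R]_n) : {in s, forall t, nonneg_form t} ->
  exists2 l : 'rV[R]_n, nonneg_form l & forall i y,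
    ([seq linform t (alpha i) | t <- s] < [seq linform t y | t <- s]
       :> seqlexi R)%O ->
    linform l (alpha i) + 1 <= linform l y.
Proof.
elim: s => [_|t s IHs st].
  exists 0 => [j|i y]; first by rewrite mxE.
  by rewrite ltxx.
have t0 : nonneg_form t by apply: st; rewrite mem_head.
have [|l l0 lP] := IHs; first by move=> u su; apply: st; rewrite inE su orbT.
have [c c0 cP] := linform_gaps t0.
(* The gap M won by the first form beats the loss l (alpha i) and leaves 1. *)
pose M := 1 + \sum_i linform l (alpha i).
have M_ge i : 1 + linform l (alpha i) <= M.
  rewrite lerD2l (bigD1 i) //= lerDl.
  by apply: sumr_ge0 => j _; apply: linform_ge0.
have M0 : 0 <= M.
  by rewrite addr_ge0 ?sumr_ge0 // => i _; apply: linform_ge0.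
exists ((M * c) *: t + l) => [j|i y /=].
  by rewrite !mxE addr_ge0 ?mulr_ge0.
rewrite !linformDZ ltxi_cons; have [lt_t|//|eq_t] /= := ltgtP (linform t (alpha i)).
  move=> _; have /(ler_wpM2l M0) := cP i y lt_t.
  have := M_ge i; have := linform_ge0 y l0; rewrite mulr1 mulrA mulrBr; lra.
by move=> /lP; rewrite eq_t -addrA lerD2l.
Qed.

(** Scaling by N turns the gap 1 into N, while rounding up the coefficients
raises the value at alpha i by at most its degree, which is less than N. *)
Lemma lex_weight (s : seq 'rV[R]_n) : {in s, forall t, nonneg_form t} ->
  exists w : 'I_n -> nat, forall i y,
    ([seq linform t (alpha i) | t <- s] < [seq linform t y | t <- s]
       :> seqlexi R)%O ->
    (wdeg w (alpha i) < wdeg w y)%N.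
Proof.
move=> /lex_form[l l0 lP]; pose N := (\sum_i mdeg (alpha i)).+1.
pose w j := (Num.Def.truncn (N%:R * l 0 j)).+1.
have Nl_ge0 j : 0 <= N%:R * l 0 j by rewrite mulr_ge0.
have w_le x : N%:R * linform l x <= (wdeg w x)%:R.
  rewrite mulr_sumr natr_sum ler_sum // => j _; rewrite natrM mulrA.
  by rewrite ler_wpM2r // ltW // truncnS_gt.
have w_ge x : (wdeg w x)%:R <= N%:R * linform l x + (mdeg x)%:R.
  rewrite mdegE !natr_sum mulr_sumr -big_split ler_sum //= => j _.
  rewrite natrM mulrA -[X in _ <= _ + X]mul1r -mulrDl ler_wpM2r // -natr1 lerD2r.
  by rewrite truncn_le.
exists w => i y /lP lxy; rewrite -(ltr_nat R).
apply: le_lt_trans (w_ge _) (lt_le_trans _ (w_le y)).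
apply: lt_le_trans (ler_wpM2l (ler0n _ N) lxy).
rewrite mulrDr mulr1 ltrD2l ltr_nat ltnS.
by rewrite (bigD1 i) //= leq_addr.
Qed.

End Weights.

(** * Division for a weighted degree *)

(** Recursion on the weight; any starting point of the iteration will do, as
the value at x is settled after w x + 1 steps. *)
Lemma graded_fixpoint (X Y : Type) (w : X -> nat) (F : (X -> Y) -> X -> Y) :
  inhabited Y ->
  (forall q q' x, (forall z, (w z < w x)%N -> q z = q' z) -> F q x = F q' x) ->
  exists q, forall x, q x = F q x.
Proof.
move=> [y0] Floc; pose Q s := iter s F (fun=> y0).
have Qstable s s' x : (w x < s)%N -> (w x < s')%N -> Q s x = Q s' x.
  elim: s s' x => [|s IHs] [|s'] x //= xs xs'.
  by apply: Floc => z zx; apply: IHs; apply: leq_trans zx _.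
exists (fun x => Q (w x).+1 x) => x.
rewrite -[LHS]/(F (Q (w x)) x); apply: Floc => z zx.
exact: Qstable.
Qed.

Section WeightedDivision.
Context (K : fieldType) (d k : nat).
Context (f : 'I_k -> {mps K[d]}) (a : 'I_k -> 'X_{1..d}) (w : 'I_d -> nat).
Context (lead_neq0 : forall i, f i (a i) != 0).
Context (lead_min : forall i e, f i e != 0 -> e != a i ->
  (wdeg w (a i) < wdeg w e)%N).
Implicit Types (b c e : 'X_{1..d}) (i j : 'I_k) (g p : {mps K[d]}).

(** The exponents with first divisor i make up the part Delta_i of the diagram
of the exponents a. *)
Definition first_divisor i c : bool :=
  (a i <= c)%MM && [forall j : 'I_k, (j < i)%N ==> ~~ (a j <= c)%MM].

Definition undivided c : bool := [forall j, ~~ (a j <= c)%MM].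

(** Division with conditions on the supports of the quotients and the remainder
instead of their Hasse derivatives. *)
Definition weighted_division g (h : 'I_k -> {mps K[d]}) p :=
  [/\ forall i b, h i b != 0 -> first_divisor i (a i + b)%MM,
      forall c, p c != 0 -> undivided c &
      g = \sum_i h i * f i + p].

Lemma first_divisor_inj i j c : first_divisor i c -> first_divisor j c -> i = j.
Proof.
move=> /andP[ic /forallP iP] /andP[jc /forallP jP]; apply/val_inj.
have := iP j; have := jP i; rewrite ic jc !implybF -!leqNgt.
by move=> ij ji; apply/eqP; rewrite eqn_leq ij ji.
Qed.

Lemma first_divisor_undivided i c : first_divisor i c -> undivided c = false.
Proof. by move=> /andP[ic _]; apply/forallPn; exists i; rewrite ic. Qed.

Lemma first_divisorP c : undivided c \/ exists i, first_divisor i c.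
Proof.
have [|/forallPn[i0]] := boolP (undivided c); first by left.
rewrite negbK => i0c; right.
case: (@arg_minnP _ i0 (fun i => (a i <= c)%MM) val i0c) => i ic imin.
exists i; rewrite /first_divisor ic /=; apply/forallP => j; apply/implyP.
by apply: contraTN => /imin; rewrite leqNgt.
Qed.

(** The coefficient of p * f i at c splits into the contribution of the initial
term of f i and the rest, which only involves coefficients of p treated before
c in a recursion on the weight. *)
Definition tail_mul i p c : K :=
  \sum_(x : 'X_{1..d < (mdeg c).+1, (mdeg c).+1} |
          (c == (x.1 + x.2)%MM) && (x.2 != a i :> 'X_{1..d}))
     p x.1 * f i x.2.

Definition lead_mul i p c : K :=
  if (a i <= c)%MM then p (c - a i)%MM * f i (a i) else 0.

Lemma mul_lead_tail i p c : (p * f i) c = lead_mul i p c + tail_mul i p c.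
Proof.
rewrite /lead_mul -[LHS]/(mps_mul p (f i) c) /=.
rewrite (bigID (fun x => val x.2 == a i)) /=; congr (_ + _).
case: ifPn => [aic|aicN].
  have cE := submK aic.
  have b1P : (mdeg (c - a i)%MM < (mdeg c).+1)%N by rewrite ltnS mdegB.
  have b2P : (mdeg (a i) < (mdeg c).+1)%N.
    by rewrite ltnS -[in leqRHS]cE mdegD leq_addl.
  rewrite (big_pred1 (BMultinom b1P, BMultinom b2P)) //= => -[b1 b2] /=.
  rewrite xpair_eqE; apply/andP/andP => -[/eqP e1 /eqP e2].
    split; apply/eqP/val_inj => //=.
    by rewrite -[LHS](addmK (a i)) -[X in (_ + X - _)%MM]e2 -e1.
  by rewrite e1 e2 /= cE.
apply: big_pred0 => x; apply/negP => /andP[/eqP cE /eqP xE].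
by move: aicN; rewrite cE -xE lem_addl.
Qed.

(** For c = b + e with e not initial, e weighs more than a i, hence c more than
a i + b, the exponent to which the coefficient of p at b is attached. *)
Lemma eq_tail_mul i p p' c :
  (forall b e, c = (b + e)%MM -> f i e != 0 ->
     (wdeg w (a i + b)%MM < wdeg w c)%N -> p b = p' b) ->
  tail_mul i p c = tail_mul i p' c.
Proof.
move=> pp'; apply: eq_bigr => x /andP[/eqP cE xN].
have [->|fN] := eqVneq (f i x.2) 0; first by rewrite !mulr0.
congr (_ * _); apply: (pp' _ x.2) => //.
by rewrite (congr1 (wdeg w) cE) !wdegD addnC ltn_add2l lead_min.
Qed.

Lemma tail_mul0 i c : tail_mul i 0 c = 0.
Proof. by apply: big1 => x _; rewrite mul0r. Qed.

Lemma mps_sumE (h : 'I_k -> {mps K[d]}) c : (\sum_i h i) c = \sum_i h i c.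
Proof. by elim/big_rec2: _ => // i x p _ <-. Qed.

Lemma divisionE (h : 'I_k -> {mps K[d]}) p c :
  (\sum_i h i * f i + p) c =
  \sum_i lead_mul i (h i) c + p c + \sum_i tail_mul i (h i) c.
Proof.
rewrite -[LHS]/((\sum_i h i * f i) c + p c) mps_sumE.
under eq_bigr do rewrite mul_lead_tail.
by rewrite big_split /= addrAC.
Qed.

(** By induction on the weight of c in P, the tails at c vanish.  In what is
left of the equation at c, the support conditions leave at most one term, a
nonzero multiple of the unknown attached to c. *)
Lemma division_vanish (P : set 'X_{1..d}) g h p :
    weighted_division g h p ->
    (forall i b e, P (b + e)%MM -> f i e != 0 -> P (a i + b)%MM) ->
    (forall c, P c -> g c = 0) ->
  (forall i b, P (a i + b)%MM -> h i b = 0) /\ (forall c, P c -> p c = 0).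
Proof.
move=> [hP pP gE] Pdown g0.
suff main c : P c -> (forall i b, c = (a i + b)%MM -> h i b = 0) /\ p c = 0.
  by split=> [i b|c] /main[+ pc] //; apply.
have [m cm] := ubnP (wdeg w c); elim: m => // m IHm in c cm * => Pc.
have tail0 i : tail_mul i (h i) c = 0.
  rewrite -(tail_mul0 i c); apply: eq_tail_mul => b e cE fN wN.
  have /IHm[|+ _] : (wdeg w (a i + b)%MM < m)%N by exact: leq_trans wN _.
    by apply: (Pdown _ _ e) => //; rewrite -cE.
  by apply.
have := g0 c Pc; rewrite gE divisionE [X in _ + X]big1 // addr0 => sum0.
have h0 i b : c = (a i + b)%MM -> h i b = 0.
  move=> cE; apply/eqP/negP => /negP hN; have ic := hP _ _ hN.
  move: sum0; rewrite (bigD1 i) //= big1 => [|j ji].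
    have -> : p c = 0.
      apply/eqP/negP => /negP/pP; rewrite cE.
      by rewrite (first_divisor_undivided ic).
    rewrite !addr0 /lead_mul cE lem_addr addmC addmK => /eqP.
    by rewrite mulf_eq0 (negPf hN) (negPf (lead_neq0 i)).
  rewrite /lead_mul; case: ifP => // jc; have [->|hjN] := eqVneq (h j (c - a j)%MM) 0.
    by rewrite mul0r.
  have := hP _ _ hjN; rewrite addmC submK // cE => /(first_divisor_inj ic) ij.
  by rewrite ij eqxx in ji.
split=> //; move: sum0; rewrite big1 ?add0r // => i _.
by rewrite /lead_mul; case: ifP => // ic; rewrite (h0 i) ?mul0r // addmC submK.
Qed.

(** A function q on all exponents encodes quotients and remainder satisfying the
support conditions: each exponent is attached to exactly one of them. *)
Definition quot_of (q : 'X_{1..d} -> K) i : {mps K[d]} :=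
  MPSeries (fun b => if first_divisor i (a i + b)%MM then q (a i + b)%MM else 0).

Definition rem_of (q : 'X_{1..d} -> K) : {mps K[d]} :=
  MPSeries (fun c => if undivided c then q c else 0).

(** The diagonal coefficient of the triangular system. *)
Definition lead_coef_at c : K :=
  if [pick i | first_divisor i c] is Some i then f i (a i) else 1.

Lemma lead_mul_quot q c :
  \sum_i lead_mul i (quot_of q i) c + rem_of q c = lead_coef_at c * q c.
Proof.
have leadE i : lead_mul i (quot_of q i) c =
    if first_divisor i c then f i (a i) * q c else 0.
  rewrite /lead_mul; case: ifPn => [ic|/negPf ic].
    by rewrite /= addmC submK // mulrC; case: ifP; rewrite // mulr0.
  by rewrite /first_divisor ic.
under eq_bigr do rewrite leadE.
rewrite /lead_coef_at; case: pickP => [i ic|noneP] /=.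
  rewrite (first_divisor_undivided ic) addr0 (bigD1 i) //= ic big1 ?addr0 //.
  move=> j ji; case: ifP => // /(first_divisor_inj ic) ij.
  by rewrite ij eqxx in ji.
have [uc|[i]] := first_divisorP c; last by rewrite noneP.
by rewrite uc mul1r big1 ?add0r // => i _; rewrite noneP.
Qed.

Lemma lead_coef_at_neq0 c : lead_coef_at c != 0.
Proof. by rewrite /lead_coef_at; case: pickP => *; rewrite ?oner_neq0. Qed.

Lemma division_exists g : exists h p, weighted_division g h p.
Proof.
(* F solves the equation at c for q c. *)
pose F q c := (lead_coef_at c)^-1 * (g c - \sum_i tail_mul i (quot_of q i) c).
have [|q qE] := @graded_fixpoint _ K (wdeg w) F (inhabits 0).
  move=> q q' c qq'; congr (_ * (_ - _)); apply: eq_bigr => i _.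
  by apply: eq_tail_mul => b e _ _ bc /=; rewrite qq'.
exists (quot_of q), (rem_of q); split=> [i b|c|].
- by rewrite /=; case: ifP; rewrite ?eqxx.
- by rewrite /=; case: ifP; rewrite ?eqxx.
apply: mpseriesP => c; rewrite divisionE lead_mul_quot qE.
by rewrite mulrA divff ?lead_coef_at_neq0 // mul1r subrK.
Qed.

Lemma weighted_divisionB g h p g' h' p' :
  weighted_division g h p -> weighted_division g' h' p' ->
  weighted_division (g - g') (fun i => h i - h' i) (p - p').
Proof.
move=> [hP pP ->] [hP' pP' ->]; split=> [i b|c|].
- rewrite -[(h i - h' i) b]/(h i b - h' i b).
  have [->|/hP//] := eqVneq (h i b) 0; rewrite sub0r oppr_eq0; exact: hP'.
- rewrite -[(p - p') c]/(p c - p' c).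
  have [->|/pP//] := eqVneq (p c) 0; rewrite sub0r oppr_eq0; exact: pP'.
rewrite opprD addrACA -sumrB; congr (_ + _).
by apply: eq_bigr => i _; rewrite mulrBl.
Qed.

Lemma division_unique g h p h' p' :
  weighted_division g h p -> weighted_division g h' p' -> h = h' /\ p = p'.
Proof.
move=> gh gh'; have := weighted_divisionB gh gh'; rewrite subrr.
move=> /(@division_vanish setT)[] // h0 p0.
split; last by apply: mpseriesP => c; apply/subr0_eq/p0.
by apply/funext => i; apply: mpseriesP => b; apply/subr0_eq/h0.
Qed.

End WeightedDivision.

(** * Exponents in two groups of variables *)

Section Split.
Context (n m : nat).
Implicit Types (x : 'X_{1..n}) (y : 'X_{1..m}) (b c : 'X_{1..n + m}).

Definition upart c : 'X_{1..n} := [multinom c (lshift m j) | j < n].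
Definition vpart c : 'X_{1..m} := [multinom c (rshift n j) | j < m].

Lemma mnm_pairl x y j : mnm_pair x y (lshift m j) = x j.
Proof. by rewrite mnmE (unsplitK (inl j)). Qed.

Lemma mnm_pairr x y j : mnm_pair x y (rshift n j) = y j.
Proof. by rewrite mnmE (unsplitK (inr j)). Qed.

Lemma mnm_pairK c : mnm_pair (upart c) (vpart c) = c.
Proof.
by apply/mnmP => j; case: (split_ordP j) => i ->;
  rewrite ?mnm_pairl ?mnm_pairr mnmE.
Qed.

Lemma upart_pair x y : upart (mnm_pair x y) = x.
Proof. by apply/mnmP => j; rewrite mnmE mnm_pairl. Qed.

Lemma upartD b c : upart (b + c)%MM = (upart b + upart c)%MM.
Proof. by apply/mnmP => j; rewrite !mnmE. Qed.

Lemma pair0_le x c : (mnm_pair x 0%MM <= c)%MM = (x <= upart c)%MM.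
Proof.
apply/mnm_lepP/mnm_lepP => le j; first by rewrite mnmE -(mnm_pairl x 0%MM).
case: (split_ordP j) => i ->; last by rewrite mnm_pairr mnm0E.
by have := le i; rewrite mnm_pairl mnmE.
Qed.

Lemma mdeg_pair0 x : mdeg (mnm_pair x (0%MM : 'X_{1..m})) = mdeg x.
Proof.
rewrite !mdegE big_split_ord /= [X in (_ + X)%N]big1 ?addn0 => [|j _].
  by apply: eq_bigr => j _; rewrite mnm_pairl.
by rewrite mnm_pairr mnm0E.
Qed.

Lemma cylinderE (A : set 'X_{1..n}) c : cylinder A c <-> A (upart c).
Proof.
split=> [[[x y] /= [Ax _] <-]|Ac]; first by rewrite upart_pair.
by exists (upart c, vpart c); rewrite ?mnm_pairK.
Qed.

(** The Hasse derivative of h at b has constant term h b, so the support of h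
lies in supd h; conversely, a nonzero derivative at b comes from an exponent
b + c in the support, and A is stable under passing from b + c to b. *)
Lemma supd_sub_cylinder (K : fieldType) (h : {mps K[n + m]}) A :
  (forall x x', A (x + x')%MM -> A x) ->
  (supd h `<=` cylinder A)%classic <-> (forall b, h b != 0 -> A (upart b)).
Proof.
move=> Adown; split=> [hA b hb|hA b].
  apply/cylinderE/hA/eqP => /(congr1 (fun p : {mps K[_]} => p 0%MM)) /=.
  rewrite addm0 big1 => [/eqP|i _]; first by rewrite mulr1n (negPf hb).
  by rewrite binn.
move=> hb; apply/cylinderE; have [c] : exists c, h (b + c)%MM != 0.
  apply: contrapT => /forallNP h0; move/eqP: hb; apply.
  apply: mpseriesP => c /=.
  by have /negP := h0 c; rewrite negbK => /eqP->; rewrite mul0rn.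
by move=> /hA; rewrite upartD; exact: Adown.
Qed.

Context (k : nat) (alpha : 'I_k -> 'X_{1..n}).

Definition alpha0 i : 'X_{1..n + m} := mnm_pair (alpha i) 0%MM.

Lemma orthantE (x x' : 'X_{1..n}) : orthant x x' <-> (x <= x')%MM.
Proof.
split=> [[c _ <-]|le]; first exact: lem_addr.
by exists (x' - x)%MM; rewrite // addmC submK.
Qed.

Lemma Gamma_partE i b :
  Gamma_part alpha i (upart b) <-> first_divisor alpha0 i (alpha0 i + b)%MM.
Proof.
have upE : upart (alpha0 i + b)%MM = (alpha i + upart b)%MM.
  by rewrite upartD upart_pair.
rewrite /first_divisor lem_addr /=; split=> [[_ H]|/forallP H].
  apply/forallP => j; apply/implyP => ji; apply/negP.
  by rewrite pair0_le upE => le; apply: H; exists j => //; apply/orthantE.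
split; first by apply/orthantE; exact: lem_addr.
move=> [j /= ji /orthantE le]; have := H j.
by rewrite ji /= pair0_le upE le.
Qed.

Lemma Gamma_part_down i x x' :
  Gamma_part alpha i (x + x')%MM -> Gamma_part alpha i x.
Proof.
move=> [_ H]; split; first by apply/orthantE; exact: lem_addr.
move=> [j ji /orthantE le]; apply: H; exists j => //; apply/orthantE.
by rewrite addmA; apply: lepm_trans le _; exact: lem_addr.
Qed.

Lemma GammaE c : Gamma alpha (upart c) <-> undivided alpha0 c.
Proof.
split=> [H|/forallP H [j _ /orthantE le]].
  apply/forallP => j; apply/negP; rewrite pair0_le => le.
  by apply: H; exists j => //; apply/orthantE.
by have := H j; rewrite pair0_le le.
Qed.

Lemma Gamma_down x x' : Gamma alpha (x + x')%MM -> Gamma alpha x.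
Proof.
move=> H [j _ /orthantE le]; apply: H; exists j => //; apply/orthantE.
by apply: lepm_trans le _; exact: lem_addr.
Qed.

Lemma is_divisionE (K : fieldType) (f : 'I_k -> {mps K[n + m]}) g h p :
  is_division f alpha g h p <-> weighted_division f alpha0 g h p.
Proof.
split=> -[hP pP gE]; split=> //.
- move=> i b hb; apply/Gamma_partE; move: b hb.
  exact/(supd_sub_cylinder _ (@Gamma_part_down i)).
- move=> c pc; apply/GammaE; move: c pc.
  exact/(supd_sub_cylinder _ Gamma_down).
- move=> i; apply/(supd_sub_cylinder _ (@Gamma_part_down i)) => b /hP.
  by move/Gamma_partE.
- by apply/(supd_sub_cylinder _ Gamma_down) => c /pP /GammaE.
Qed.

End Split.

(** * The weight attached to the initial exponents *)

(** The order given by the forms may have ties, but a tie with x in the support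
would be a second minimum. *)
Lemma initial_exp_lt (R : realType) (n r : nat) (T : r.-tuple 'rV[R]_n)
    (K : fieldType) (p : {mps K[n]}) x y :
  is_initial_exp T p x -> p y != 0 -> y != x ->
  ([seq linform t x | t <- T] < [seq linform t y | t <- T] :> seqlexi R)%O.
Proof.
have valE z : [seq linform t z | t <- T] = forms_val T z :> seq R.
  rewrite -[LHS]/(val [tuple of map (fun t => linform t z) T]); congr val.
  by apply: eq_from_tnth => i; rewrite tnth_map tnth_mktuple.
move=> [[px xmin] xuniq] py yx; rewrite !valE.
rewrite -[(_ < _)%O]/(forms_val T x < forms_val T y)%O lt_neqAle.
rewrite [X in _ && X](xmin y) // andbT; apply/eqP => xyE.
move/eqP: yx; apply; apply/esym/xuniq; split=> // z pz.
by rewrite /le_forms -xyE; exact: xmin.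
Qed.

(** Terms of f i free of v are compared with alpha i by the weight from the
forms; the other ones contain a variable of weight M, more than the weight of
any alpha i. *)
Lemma initial_weight (K : fieldType) (R : realType) (n m r k : nat)
    (T : r.-tuple 'rV[R]_n) (f : 'I_k -> {mps K[n + m]})
    (alpha : 'I_k -> 'X_{1..n}) :
    (forall i, nonneg_form (tnth T i)) ->
    (forall i, is_initial_exp T (eval_v0 (f i)) (alpha i)) ->
  exists w : 'I_(n + m) -> nat, forall i e, f i e != 0 ->
    e != alpha0 m alpha i -> (wdeg w (alpha0 m alpha i) < wdeg w e)%N.
Proof.
move=> T0 fexp; have [|w wP] := @lex_weight R n k alpha T.
  by move=> t /tnthP[i ->].
pose M := (\sum_i wdeg w (alpha i)).+1.
exists (fun j => match fintype.split j with inl j => w j | inr _ => M end).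
set W := fun j => _ => i e fe eN.
have WE c : wdeg W c = (wdeg w (upart c) + M * mdeg (vpart c))%N.
  rewrite /wdeg big_split_ord mdegE big_distrr /=; congr (_ + _)%N.
    by apply: eq_bigr => j _; rewrite /W (unsplitK (inl j)) mnmE.
  by apply: eq_bigr => j _; rewrite /W (unsplitK (inr j)) mnmE.
have -> : wdeg W (alpha0 m alpha i) = wdeg w (alpha i).
  rewrite WE upart_pair (_ : vpart _ = 0%MM) ?mdeg0 ?muln0 ?addn0 //.
  by apply/mnmP => j; rewrite !mnmE (unsplitK (inr j)) mnm0E.
rewrite WE; have [v0|vN] := eqVneq (vpart e) 0%MM.
  apply: leq_trans (leq_addr _ _); apply: wP.
  apply: (initial_exp_lt (fexp i)); first by rewrite /= -v0 mnm_pairK.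
  by apply: contraNneq eN => eE; rewrite -(mnm_pairK e) v0 eE.
apply: leq_trans (leq_addl _ _).
apply: (@leq_trans M); first by rewrite ltnS (bigD1 i) //= leq_addr.
by rewrite leq_pmulr // lt0n mdeg_eq0.
Qed.

(** * Orders and the division theorem *)

Lemma lt_ord_coef0 (K : fieldType) d (p : {mps K[d]}) b :
  (EFin (mdeg b)%:Z < ord p)%O -> p b = 0.
Proof.
rewrite /ord; case: pselect => [ex|nex] lt; apply/eqP/negP => /negP pb.
  move: lt; case: ex_minnP => e _ /(_ (mdeg b)).
  rewrite asboolT; last by exists b.
  by move=> /(_ isT) le; rewrite ltNge leEereal /= lez_nat le.
by apply: nex; exists (mdeg b); apply/asboolP; exists b.
Qed.

Lemma le_ord (K : fieldType) d (p : {mps K[d]}) z :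
  (forall b, p b != 0 -> (z <= EFin (mdeg b)%:Z)%O) -> (z <= ord p)%O.
Proof.
move=> zP; rewrite /ord; case: pselect => [ex|_]; last exact: leey.
by case: ex_minnP => e /asboolP[b pb <-] _; exact: zP.
Qed.

Theorem theorem3p1p9 (K : fieldType) (R : realType) (n m r k : nat)
    (T : r.-tuple 'rV[R]_n)
    (Tnonneg : forall i, nonneg_form (tnth T i))
    (Tpos : positive_forms T)
    (f : 'I_k -> {mps K[n + m]}) (alpha : 'I_k -> 'X_{1..n})
    (fexp : forall i, is_initial_exp T (eval_v0 (f i)) (alpha i)) :
  (forall g : {mps K[n + m]},
     exists! hr : ('I_k -> {mps K[n + m]}) * {mps K[n + m]},
       is_division f alpha g hr.1 hr.2)
  /\ ((forall i, ord (f i) = EFin (mdeg (alpha i))%:Z) ->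
      forall (g : {mps K[n + m]}) (h : 'I_k -> {mps K[n + m]})
             (rem : {mps K[n + m]}),
        is_division f alpha g h rem ->
        (ord g <= ord rem)%O
        /\ forall i, (adde (ord g) (oppe (EFin (mdeg (alpha i))%:Z)) <= ord (h i))%O).
Proof.
have [w lead_min] := initial_weight Tnonneg fexp.
have lead_neq0 i : f i (alpha0 m alpha i) != 0 by case: (fexp i) => -[].
split=> [g|ordf g h rem /is_divisionE div].
  have [h [p div]] := division_exists lead_neq0 lead_min g.
  exists (h, p); split=> [|[h' p']]; first exact/is_divisionE.
  move=> /is_divisionE div'.
  by have [-> ->] := division_unique lead_neq0 lead_min div div'.
(* P is related only to itself: every e in the support of f i has degree at
   least that of alpha i, so alpha_i + b has at most the degree of b + e. *)
pose P : set 'X_{1..n + m} := fun c => (EFin (mdeg c)%:Z < ord g)%O.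
have [|c Pc|h0 rem0] := division_vanish lead_neq0 lead_min (P := P) div.
- move=> i b e Pbe fe; apply: le_lt_trans Pbe.
  have : (EFin (mdeg (alpha i))%:Z <= EFin (mdeg e)%:Z)%O.
    by rewrite -ordf leNgt; apply: contra fe => /lt_ord_coef0->.
  by rewrite !leEereal /= !lez_nat !mdegD mdeg_pair0 (addnC (mdeg b)) leq_add2r.
- exact: lt_ord_coef0 Pc.
split=> [|i]; apply: le_ord => b; rewrite leNgt; apply: contra => lt.
  by apply/eqP/rem0.
apply/eqP/h0; move: lt; rewrite /P mdegD mdeg_pair0.
case: (ord g) => [z| |] //; rewrite !ltEereal /= PoszD; lra.
Qed.
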